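(* Let $J\colon\mathcal A\to\mathcal E$ be a pseudofunctor between bicategories and let $T$ be a $J$-relative pseudomonad. Suppose that $\mathcal E$ is a 2-category. The Kleisli bicategory $\mathrm{Kl}(T)$ is biequivalent to $\mathrm{Im}(F_T)$, the full and locally full sub-2-category of the 2-category $\mathrm{PsAlg}(T)$ of $T$-pseudoalgebras and pseudomorphisms spanned by the free $T$-pseudoalgebras.
   Context: Conventions. For a bicategory $\mathcal E$, $\mathcal E[X,Y]$ is the hom-category; composition of 1-cells and whiskering are written by juxtaposition, vertical composition of 2-cells by $\circ$; structural isomorphisms (associators, unitors, pseudofunctor constraints) are left implicit in equations or written $\cong$. A $J$-relative pseudomonad $T$ comprises: an object $TX\in\mathcal E$ for each $X\in\mathcal A$; functors $(-)^*\colon\mathcal E[JX,TY]\to\mathcal E[TX,TY]$ for $X,Y\in\mathcal A$; 1-cells $i_X\colon JX\to TX$; invertible 2-cells $\mu_{g,f}\colon(g^*f)^*\Rightarrow g^*f^*$ natural in $f\colon JX\to TY$, $g\colon JY\to TZ$; invertible 2-cells $\eta_f\colon f\Rightarrow f^*i_X$ natural in $f\colon JX\to TY$; invertible 2-cells $\theta_X\colon(i_X)^*\Rightarrow 1_{TX}$; such that $(\mu_{h,g}f^* )\circ\mu_{h^*g,f}=(h^*\mu_{g,f})\circ\mu_{h,g^*f}\circ(\mu_{h,g}f)^*$ for all $f\colon JW\to TX$, $g\colon JX\to TY$, $h\colon JY\to TZ$, and $(f^*\theta_X)\circ\mu_{f,i_X}\circ(\eta_f)^*$ is the structural isomorphism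 $f^*\cong f^*1_{TX}$ for all $f\colon JX\to TY$. A $T$-pseudoalgebra $(A,(-)^a,\hat a,\tilde a)$ comprises: an object $A\in\mathcal E$; functors $(-)^a\colon\mathcal E[JX,A]\to\mathcal E[TX,A]$ for $X\in\mathcal A$; invertible 2-cells $\hat a_{g,f}\colon(g^af)^a\Rightarrow g^af^*$ natural in $f\colon JX\to TY$, $g\colon JY\to A$; invertible 2-cells $\tilde a_f\colon f\Rightarrow f^ai_X$ natural in $f\colon JX\to A$; such that $(\hat a_{h,g}f^* )\circ\hat a_{h^ag,f}=(h^a\mu_{g,f})\circ\hat a_{h,g^*f}\circ(\hat a_{h,g}f)^a$ for all $f\colon JX\to TY$, $g\colon JY\to TZ$, $h\colon JZ\to A$, and $(f^a\theta_X)\circ\hat a_{f,i_X}\circ(\tilde a_f)^a$ is the structural isomorphism $f^a\cong f^a1_{TX}$ for all $f\colon JX\to A$. A pseudomorphism $(h,\overline h)\colon(A,(-)^a,\hat a,\tilde a)\to(B,(-)^b,\hat b,\tilde b)$ comprises a 1-cell $h\colon A\to B$ and invertible 2-cells $\overline h_f\colon(hf)^b\Rightarrow hf^a$ natural in $f\colon JX\to A$ such that $(h\hat a_{g,f})\circ\overline h_{g^af}\circ(\overline h_gf)^b=(\overline h_gf^* )\circ\hat b_{hg,f}$ for all $f\colon JX\to TY$, $g\colon JY\to A$, and $(\overline h_fi_X)\circ\tilde b_{hf}=h\tilde a_f$. A transformation $(h,\overline h)\Rightarrow(h',\overline{h'})$ is a 2-cell $\alpha\colon h\Rightarrow h'$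 with $\overline{h'}_f\circ(\alpha f)^b=(\alpha f^a)\circ\overline h_f$. These form the bicategory $\mathrm{PsAlg}(T)$, a 2-category when $\mathcal E$ is: identities are $1_A$ with $(1_Af)^a\cong f^a\cong1_Af^a$; composites are $h'h$ with $((h'h)f)^c\cong(h'(hf))^c\xrightarrow{\overline{h'}_{hf}}h'(hf)^b\xrightarrow{h'\overline h_f}h'(hf^a)\cong(h'h)f^a$; the rest is as in $\mathcal E$. The free $T$-pseudoalgebra on $X\in\mathcal A$ is $F_TX=(TX,(-)^*,\mu,\eta)$. $\mathrm{Im}(F_T)$ is the full image of $F_T\colon\mathcal A\to\mathrm{PsAlg}(T)$: its objects are those of $\mathcal A$ and $\mathrm{Im}(F_T)[X,Y]=\mathrm{PsAlg}(T)[F_TX,F_TY]$. The Kleisli bicategory $\mathrm{Kl}(T)$ has the objects of $\mathcal A$ and $\mathrm{Kl}(T)[X,Y]=\mathcal E[JX,TY]$; the identity on $X$ is $i_X$; the composite of $f\colon JX\to TY$ and $g\colon JY\to TZ$ is $g^*f$; associators and unitors are induced by $\mu,\theta,\eta$. *)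

(* Defs.v *)
From Stdlib Require Import ssreflect FunctionalExtensionality ProofIrrelevance.

Set Implicit Arguments.
Unset Strict Implicit.
Unset Printing Implicit Defensive.

Declare Scope bicat_scope.
Delimit Scope bicat_scope with bicat.
Local Open Scope bicat_scope.

Reserved Notation "x ⇒ y" (at level 70, no associativity).
Reserved Notation "b ∘ a" (at level 50, left associativity).
Reserved Notation "g · f" (at level 40, left associativity).
Reserved Notation "g ◁ a" (at level 40, no associativity).
Reserved Notation "b ▷ f" (at level 40, no associativity).

Record Category := {
  cat_ob :> Type;
  arr : cat_ob -> cat_ob -> Type;
  idarr : forall x, arr x x;
  vcomp : forall {x y z}, arr y z -> arr x y -> arr x z;
  vcomp_id_l : forall x y (a : arr x y), vcomp (idarr y) a = a;
  vcomp_id_r : forall x y (a : arr x y), vcomp a (idarr x) = a;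
  vcomp_assoc : forall w x y z (c : arr y z) (b : arr x y) (a : arr w x),
    vcomp (vcomp c b) a = vcomp c (vcomp b a)
}.
Arguments arr {_} _ _.
Arguments idarr {_} _.
Arguments vcomp {_ _ _ _} _ _.

Notation "x ⇒ y" := (arr x y) : bicat_scope.
Notation "b ∘ a" := (vcomp b a) : bicat_scope.

Record Iso (C : Category) (x y : C) := {
  iso_fwd :> x ⇒ y;
  iso_inv : y ⇒ x;
  iso_inv_fwd : iso_inv ∘ iso_fwd = idarr x;
  iso_fwd_inv : iso_fwd ∘ iso_inv = idarr y
}.
Arguments Iso {_} _ _.

Definition is_invertible (C : Category) (x y : C) (a : x ⇒ y) : Prop :=
  exists b : y ⇒ x, b ∘ a = idarr x /\ a ∘ b = idarr y.

Record Functor (C D : Category) := {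
  fun_ob :> C -> D;
  fmap : forall {x y : C}, x ⇒ y -> fun_ob x ⇒ fun_ob y;
  fmap_id : forall x, fmap (idarr x) = idarr (fun_ob x);
  fmap_comp : forall x y z (b : y ⇒ z) (a : x ⇒ y),
    fmap (b ∘ a) = fmap b ∘ fmap a
}.
Arguments fmap {_ _} _ {_ _} _.

(* Bicategories, with horizontal composition of 2-cells presented by the two
   whiskerings: [g ◁ a] is the whiskering written g a, and [b ▷ f] is b f. *)
Record Bicategory := {
  bi_ob :> Type;
  hom : bi_ob -> bi_ob -> Category;
  id1 : forall a, hom a a;
  hcomp : forall {a b c}, hom b c -> hom a b -> hom a c;
  lwhisk : forall {a b c} (g : hom b c) {f f' : hom a b},
    f ⇒ f' -> hcomp g f ⇒ hcomp g f';
  rwhisk : forall {a b c} {g g' : hom b c},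
    g ⇒ g' -> forall f : hom a b, hcomp g f ⇒ hcomp g' f;
  assoc : forall {a b c d} (h : hom c d) (g : hom b c) (f : hom a b),
    Iso (hcomp (hcomp h g) f) (hcomp h (hcomp g f));
  lunit : forall {a b} (f : hom a b), Iso (hcomp (id1 b) f) f;
  runit : forall {a b} (f : hom a b), Iso (hcomp f (id1 a)) f;

  lwhisk_id : forall a b c (g : hom b c) (f : hom a b),
    lwhisk g (idarr f) = idarr (hcomp g f);
  lwhisk_comp : forall a b c (g : hom b c) (f f' f'' : hom a b)
      (y : f' ⇒ f'') (x : f ⇒ f'),
    lwhisk g (y ∘ x) = lwhisk g y ∘ lwhisk g x;
  rwhisk_id : forall a b c (g : hom b c) (f : hom a b),
    rwhisk (idarr g) f = idarr (hcomp g f);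
  rwhisk_comp : forall a b c (g g' g'' : hom b c) (y : g' ⇒ g'') (x : g ⇒ g')
      (f : hom a b),
    rwhisk (y ∘ x) f = rwhisk y f ∘ rwhisk x f;
  interchange : forall a b c (g g' : hom b c) (y : g ⇒ g') (f f' : hom a b)
      (x : f ⇒ f'),
    rwhisk y f' ∘ lwhisk g x = lwhisk g' x ∘ rwhisk y f;

  assoc_nat_l : forall a b c d (h h' : hom c d) (x : h ⇒ h') (g : hom b c)
      (f : hom a b),
    assoc h' g f ∘ rwhisk (rwhisk x g) f = rwhisk x (hcomp g f) ∘ assoc h g f;
  assoc_nat_m : forall a b c d (h : hom c d) (g g' : hom b c) (x : g ⇒ g')
      (f : hom a b),
    assoc h g' f ∘ rwhisk (lwhisk h x) f = lwhisk h (rwhisk x f) ∘ assoc h g f;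
  assoc_nat_r : forall a b c d (h : hom c d) (g : hom b c) (f f' : hom a b)
      (x : f ⇒ f'),
    assoc h g f' ∘ lwhisk (hcomp h g) x = lwhisk h (lwhisk g x) ∘ assoc h g f;
  lunit_nat : forall a b (f f' : hom a b) (x : f ⇒ f'),
    lunit f' ∘ lwhisk (id1 b) x = x ∘ lunit f;
  runit_nat : forall a b (f f' : hom a b) (x : f ⇒ f'),
    runit f' ∘ rwhisk x (id1 a) = x ∘ runit f;

  triangle : forall a b c (g : hom b c) (f : hom a b),
    lwhisk g (lunit f) ∘ assoc g (id1 b) f = rwhisk (runit g) f;
  pentagon : forall a b c d e (k : hom d e) (h : hom c d) (g : hom b c)
      (f : hom a b),
    assoc k h (hcomp g f) ∘ assoc (hcomp k h) g f
    = lwhisk k (assoc h g f) ∘ assoc k (hcomp h g) f ∘ rwhisk (assoc k h g) f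
}.
Arguments hom {_} _ _.
Arguments id1 {_} _.
Arguments hcomp {_ _ _ _} _ _.
Arguments lwhisk {_ _ _ _} _ {_ _} _.
Arguments rwhisk {_ _ _ _ _ _} _ _.
Arguments assoc {_ _ _ _ _} _ _ _.
Arguments lunit {_ _ _} _.
Arguments runit {_ _ _} _.

Notation "g · f" := (hcomp g f) : bicat_scope.
Notation "g ◁ a" := (lwhisk g a) : bicat_scope.
Notation "b ▷ f" := (rwhisk b f) : bicat_scope.

Definition id_cast (C : Category) (x y : C) (e : x = y) : x ⇒ y :=
  match e in _ = z return x ⇒ z with eq_refl => idarr x end.

(* A bicategory is a 2-category when its structural isomorphisms are identities,
   transported along the equations of 1-cells that this presupposes. *)
Record Is2Category (B : Bicategory) : Prop := {
  assoc_strict : forall (a b c d : B) (h : hom c d) (g : hom b c) (f : hom a b),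
    exists e : (h · g) · f = h · (g · f), iso_fwd (assoc h g f) = id_cast e;
  lunit_strict : forall (a b : B) (f : hom a b),
    exists e : id1 b · f = f, iso_fwd (lunit f) = id_cast e;
  runit_strict : forall (a b : B) (f : hom a b),
    exists e : f · id1 a = f, iso_fwd (runit f) = id_cast e
}.

Ltac va := rewrite ?vcomp_assoc.

Section Isos.
Context (C : Category).

Lemma reassoc (x y z w : C) (a : x ⇒ y) (b : y ⇒ z) (c : x ⇒ w) (d : w ⇒ z) :
  b ∘ a = d ∘ c -> forall v (k : v ⇒ x), b ∘ (a ∘ k) = d ∘ (c ∘ k).
Proof. by move=> H v k; rewrite -!vcomp_assoc H. Qed.

Lemma reassoc1 (x y z : C) (a : x ⇒ y) (b : y ⇒ z) (c : x ⇒ z) :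
  b ∘ a = c -> forall v (k : v ⇒ x), b ∘ (a ∘ k) = c ∘ k.
Proof. by move=> H v k; rewrite -!vcomp_assoc H. Qed.

Lemma reassoc13 (x y z w : C) (a : x ⇒ y) (b : y ⇒ z) (r : z ⇒ w) (c : x ⇒ w) :
  r ∘ b ∘ a = c -> forall v (k : v ⇒ x), r ∘ (b ∘ (a ∘ k)) = c ∘ k.
Proof. by move=> H v k; rewrite -!vcomp_assoc H. Qed.

Lemma reassoc3 (x y z w : C) (a : x ⇒ y) (b : y ⇒ z) (c : x ⇒ w) (d : w ⇒ z)
  (u : C) (r : z ⇒ u) (t : w ⇒ u) :
  r ∘ (b ∘ a) = t ∘ c -> forall v (k : v ⇒ x), r ∘ (b ∘ (a ∘ k)) = t ∘ (c ∘ k).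
Proof. by move=> H v k; rewrite -!vcomp_assoc -H !vcomp_assoc. Qed.

Lemma inv_fwd_k (x y : C) (i : Iso x y) w (k : w ⇒ x) : iso_inv i ∘ (i ∘ k) = k.
Proof. by rewrite -vcomp_assoc iso_inv_fwd vcomp_id_l. Qed.
Lemma fwd_inv_k (x y : C) (i : Iso x y) w (k : w ⇒ y) : i ∘ (iso_inv i ∘ k) = k.
Proof. by rewrite -vcomp_assoc iso_fwd_inv vcomp_id_l. Qed.

Lemma iso_mono (x y : C) (i : Iso x y) w (a b : w ⇒ x) : i ∘ a = i ∘ b -> a = b.
Proof. by move=> H; rewrite -(inv_fwd_k i a) H inv_fwd_k. Qed.
Lemma iso_epi (x y : C) (i : Iso x y) w (a b : y ⇒ w) : a ∘ i = b ∘ i -> a = b.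
Proof.
move=> H; rewrite -(vcomp_id_r a) -(vcomp_id_r b) -(iso_fwd_inv i).
by rewrite -!vcomp_assoc H.
Qed.

Lemma iso_ext (x y : C) (i j : Iso x y) : iso_fwd i = iso_fwd j -> i = j.
Proof.
case: i j => [f g p q] [f' g' p' q'] /= E; subst f'.
have E : g = g'.
  by rewrite -(vcomp_id_r g) -q' -vcomp_assoc p vcomp_id_l.
subst g'; congr Build_Iso; exact: proof_irrelevance.
Qed.

Definition idiso (x : C) : Iso x x.
Proof. by exists (idarr x) (idarr x); rewrite vcomp_id_l. Defined.
Definition symiso (x y : C) (i : Iso x y) : Iso y x.
Proof. by exists (iso_inv i) (iso_fwd i); [apply: iso_fwd_inv|apply: iso_inv_fwd]. Defined.
Definition compiso (x y z : C) (j : Iso y z) (i : Iso x y) : Iso x z.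
Proof.
exists (j ∘ i) (iso_inv i ∘ iso_inv j).
- by rewrite vcomp_assoc inv_fwd_k iso_inv_fwd.
- by rewrite vcomp_assoc fwd_inv_k iso_fwd_inv.
Defined.
End Isos.

Definition fmapiso (C D : Category) (F : Functor C D) (x y : C) (i : Iso x y) :
  Iso (F x) (F y).
Proof.
exists (fmap F i) (fmap F (iso_inv i)).
- by rewrite -fmap_comp iso_inv_fwd fmap_id.
- by rewrite -fmap_comp iso_fwd_inv fmap_id.
Defined.

Section BicatTheory.
Context (B : Bicategory).

Definition lwiso (a b c : B) (g : hom b c) (f f' : hom a b) (i : Iso f f') :
  Iso (g · f) (g · f').
Proof.
exists (g ◁ i) (g ◁ iso_inv i).
- by rewrite -lwhisk_comp iso_inv_fwd lwhisk_id.
- by rewrite -lwhisk_comp iso_fwd_inv lwhisk_id.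
Defined.
Definition rwiso (a b c : B) (g g' : hom b c) (i : Iso g g') (f : hom a b) :
  Iso (g · f) (g' · f).
Proof.
exists (i ▷ f) (iso_inv i ▷ f).
- by rewrite -rwhisk_comp iso_inv_fwd rwhisk_id.
- by rewrite -rwhisk_comp iso_fwd_inv rwhisk_id.
Defined.

Lemma lwhisk_comp_k (a b c : B) (g : hom b c) (f f' f'' : hom a b)
  (y : f' ⇒ f'') (x : f ⇒ f') w (z : w ⇒ _) :
  (g ◁ y) ∘ ((g ◁ x) ∘ z) = (g ◁ (y ∘ x)) ∘ z.
Proof. by rewrite lwhisk_comp vcomp_assoc. Qed.

Lemma lwhisk1_inj (a b : B) (f f' : hom a b) (x y : f ⇒ f') :
  id1 b ◁ x = id1 b ◁ y -> x = y.
Proof. by move=> H; apply: (@iso_epi _ _ _ (lunit f)); rewrite -!lunit_nat H. Qed.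
Lemma rwhisk1_inj (a b : B) (f f' : hom a b) (x y : f ⇒ f') :
  x ▷ id1 a = y ▷ id1 a -> x = y.
Proof. by move=> H; apply: (@iso_epi _ _ _ (runit f)); rewrite -!runit_nat H. Qed.

Lemma lunit_hcomp (a b c : B) (g : hom b c) (f : hom a b) :
  lunit (g · f) ∘ assoc (id1 c) g f = lunit g ▷ f.
Proof.
apply: lwhisk1_inj.
apply: (@iso_epi _ _ _ (assoc (id1 c) (id1 c · g) f)).
apply: (@iso_epi _ _ _ (rwiso (assoc (id1 c) (id1 c) g) f)) => /=.
rewrite lwhisk_comp !vcomp_assoc.
have P := pentagon (id1 c) (id1 c) g f.
rewrite vcomp_assoc in P; rewrite -P -vcomp_assoc triangle.
rewrite -assoc_nat_l -triangle rwhisk_comp -vcomp_assoc assoc_nat_m.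
by rewrite vcomp_assoc.
Qed.

Lemma runit_hcomp (a b c : B) (g : hom b c) (f : hom a b) :
  (g ◁ runit f) ∘ assoc g f (id1 a) = runit (g · f).
Proof.
apply: rwhisk1_inj.
apply: (@iso_mono _ _ _ (assoc g f (id1 a))).
rewrite rwhisk_comp -vcomp_assoc assoc_nat_m -triangle lwhisk_comp.
rewrite -(triangle (g · f)) -[RHS]vcomp_assoc assoc_nat_r !vcomp_assoc.
by rewrite pentagon vcomp_assoc.
Qed.

Lemma lunit_runit_id1 (a : B) : iso_fwd (lunit (id1 a)) = runit (id1 a).
Proof.
apply: rwhisk1_inj.
rewrite -triangle -lunit_hcomp; congr vcomp.
apply: (@iso_mono _ _ _ (lunit (id1 a))).
by rewrite lunit_nat.
Qed.

End BicatTheory.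

Lemma inv_swap (C : Category) (x y z w : C) (i : Iso x y) (j : Iso z w)
  (u : y ⇒ w) (v : x ⇒ z) :
  j ∘ v = u ∘ i -> iso_inv j ∘ u = v ∘ iso_inv i.
Proof.
move=> H; apply: (@iso_mono _ _ _ j); apply: (@iso_epi _ _ _ i).
by rewrite !vcomp_assoc fwd_inv_k iso_inv_fwd vcomp_id_r.
Qed.

Section Pasting.
Context (B : Bicategory).

(* [s : u' · p ⇒ q · u] is read as a square; [vpaste t s] glues [s] on top of [t],
   and [hpaste s' s] glues [s'] to the right of [s]. *)
Definition vpaste (a a1 a2 b b1 b2 : B) (f : hom a b) (f1 : hom a1 b1)
    (f2 : hom a2 b2) (s : hom a a1) (s' : hom b b1) (t : hom a1 a2)
    (t' : hom b1 b2) (y : f2 · t ⇒ t' · f1) (x : f1 · s ⇒ s' · f) :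
  f2 · (t · s) ⇒ (t' · s') · f :=
  iso_inv (assoc t' s' f) ∘ (t' ◁ x) ∘ assoc t' f1 s ∘ (y ▷ s)
    ∘ iso_inv (assoc f2 t s).

Definition hpaste (a b c a' b' c' : B) (f : hom a b) (g : hom b c)
    (f' : hom a' b') (g' : hom b' c') (p : hom a a') (q : hom b b') (r : hom c c')
    (y : g' · q ⇒ r · g) (x : f' · p ⇒ q · f) :
  (g' · f') · p ⇒ r · (g · f) :=
  assoc r g f ∘ (y ▷ f) ∘ iso_inv (assoc g' q f) ∘ (g' ◁ x) ∘ assoc g' f' p.

Definition idsq (a b : B) (s : hom a b) : id1 b · s ⇒ s · id1 a :=
  iso_inv (runit s) ∘ lunit s.
End Pasting.

Record Pseudofunctor (B C : Bicategory) := {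
  pf_ob :> B -> C;
  pf_hom : forall {a b : B}, Functor (hom a b) (hom (pf_ob a) (pf_ob b));
  pf_id : forall a : B, Iso (id1 (pf_ob a)) (pf_hom (id1 a));
  pf_comp : forall {a b c : B} (g : hom b c) (f : hom a b),
    Iso (pf_hom g · pf_hom f) (pf_hom (g · f));
  pf_comp_nat_l : forall (a b c : B) (g g' : hom b c) (y : g ⇒ g') (f : hom a b),
    pf_comp g' f ∘ (fmap pf_hom y ▷ pf_hom f)
    = fmap pf_hom (y ▷ f) ∘ pf_comp g f;
  pf_comp_nat_r : forall (a b c : B) (g : hom b c) (f f' : hom a b) (x : f ⇒ f'),
    pf_comp g f' ∘ (pf_hom g ◁ fmap pf_hom x)
    = fmap pf_hom (g ◁ x) ∘ pf_comp g f;
  pf_lunit : forall (a b : B) (f : hom a b),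
    fmap pf_hom (lunit f) ∘ pf_comp (id1 b) f ∘ (pf_id b ▷ pf_hom f)
    = lunit (pf_hom f);
  pf_runit : forall (a b : B) (f : hom a b),
    fmap pf_hom (runit f) ∘ pf_comp f (id1 a) ∘ (pf_hom f ◁ pf_id a)
    = runit (pf_hom f);
  pf_assoc : forall (a b c d : B) (h : hom c d) (g : hom b c) (f : hom a b),
    fmap pf_hom (assoc h g f) ∘ pf_comp (h · g) f ∘ (pf_comp h g ▷ pf_hom f)
    = pf_comp h (g · f) ∘ (pf_hom h ◁ pf_comp g f)
        ∘ assoc (pf_hom h) (pf_hom g) (pf_hom f)
}.
Arguments pf_hom {_ _} _ {_ _}.
Arguments pf_id {_ _} _ _.
Arguments pf_comp {_ _} _ {_ _ _} _ _.

Record Pseudonat (B C : Bicategory) (F G : Pseudofunctor B C) := {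
  pn_ob :> forall a : B, hom (F a) (G a);
  pn_hom : forall {a b : B} (f : hom a b),
    Iso (pf_hom G f · pn_ob a) (pn_ob b · pf_hom F f);
  pn_nat : forall (a b : B) (f f' : hom a b) (x : f ⇒ f'),
    pn_hom f' ∘ (fmap (pf_hom G) x ▷ pn_ob a)
    = (pn_ob b ◁ fmap (pf_hom F) x) ∘ pn_hom f;
  pn_id : forall a : B,
    pn_hom (id1 a) ∘ (pf_id G a ▷ pn_ob a)
    = (pn_ob a ◁ pf_id F a) ∘ iso_inv (runit (pn_ob a)) ∘ lunit (pn_ob a);
  pn_comp : forall (a b c : B) (g : hom b c) (f : hom a b),
    pn_hom (g · f) ∘ (pf_comp G g f ▷ pn_ob a)
    = (pn_ob c ◁ pf_comp F g f) ∘ assoc (pn_ob c) (pf_hom F g) (pf_hom F f)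
        ∘ (pn_hom g ▷ pf_hom F f)
        ∘ iso_inv (assoc (pf_hom G g) (pn_ob b) (pf_hom F f))
        ∘ (pf_hom G g ◁ pn_hom f) ∘ assoc (pf_hom G g) (pf_hom G f) (pn_ob a)
}.
Arguments pn_hom {_ _ _ _} _ {_ _} _.

Record Modification (B C : Bicategory) (F G : Pseudofunctor B C)
    (s t : Pseudonat F G) := {
  md_ob :> forall a : B, s a ⇒ t a;
  md_nat : forall (a b : B) (f : hom a b),
    pn_hom t f ∘ (pf_hom G f ◁ md_ob a) = (md_ob b ▷ pf_hom F f) ∘ pn_hom s f
}.

Section PseudofunctorOps.
Context (B C D : Bicategory).

Definition idfunctor (X : Category) : Functor X X.
Proof. by exists (fun x => x) (fun x y a => a). Defined.

Definition compfunctor (X Y Z : Category) (G : Functor Y Z) (F : Functor X Y) :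
  Functor X Z.
Proof.
exists (fun x => G (F x)) (fun x y a => fmap G (fmap F a)).
- by move=> x; rewrite !fmap_id.
- by move=> x y z b a; rewrite !fmap_comp.
Defined.

Definition idpf : Pseudofunctor B B.
Proof.
exists (fun a => a) (fun a b => idfunctor (hom a b)) (fun a => idiso (id1 a))
       (fun a b c g f => idiso (g · f)) => /=.
- by move=> *; rewrite vcomp_id_l vcomp_id_r.
- by move=> *; rewrite vcomp_id_l vcomp_id_r.
- by move=> *; rewrite rwhisk_id !vcomp_id_r.
- by move=> *; rewrite lwhisk_id !vcomp_id_r.
- by move=> *; rewrite lwhisk_id rwhisk_id !vcomp_id_r !vcomp_id_l.
Defined.

Definition comppf (G : Pseudofunctor C D) (F : Pseudofunctor B C) :
  Pseudofunctor B D.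
Proof.
exists (fun a => G (F a)) (fun a b => compfunctor (pf_hom G) (pf_hom F))
       (fun a => compiso (fmapiso (pf_hom G) (pf_id F a)) (pf_id G (F a)))
       (fun a b c g f => compiso (fmapiso (pf_hom G) (pf_comp F g f))
                                 (pf_comp G (pf_hom F g) (pf_hom F f))) => /=.
- move=> *; rewrite vcomp_assoc pf_comp_nat_l -!vcomp_assoc -!fmap_comp.
  by rewrite pf_comp_nat_l.
- move=> *; rewrite vcomp_assoc pf_comp_nat_r -!vcomp_assoc -!fmap_comp.
  by rewrite pf_comp_nat_r.
- move=> a b f; rewrite rwhisk_comp; va.
  rewrite (reassoc (pf_comp_nat_l G _ _)) -!vcomp_assoc -!fmap_comp.
  by rewrite pf_lunit pf_lunit.
- move=> a b f; rewrite lwhisk_comp; va.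
  rewrite (reassoc (pf_comp_nat_r G _ _)) -!vcomp_assoc -!fmap_comp.
  by rewrite pf_runit pf_runit.
- move=> a b c d h g f; rewrite lwhisk_comp rwhisk_comp; va.
  rewrite (reassoc (pf_comp_nat_l G _ _)) (reassoc (pf_comp_nat_r G _ _)).
  rewrite -!vcomp_assoc -!fmap_comp pf_assoc !fmap_comp; va.
  by have := pf_assoc G (pf_hom F h) (pf_hom F g) (pf_hom F f); rewrite !vcomp_assoc => ->.
Defined.

End PseudofunctorOps.

Section PseudonatOps.
Context (B C : Bicategory).

Definition vpaste_iso (a a1 a2 b b1 b2 : C) (f : hom a b) (f1 : hom a1 b1)
    (f2 : hom a2 b2) (s : hom a a1) (s' : hom b b1) (t : hom a1 a2)
    (t' : hom b1 b2) (y : Iso (f2 · t) (t' · f1)) (x : Iso (f1 · s) (s' · f)) :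
  Iso (f2 · (t · s)) ((t' · s') · f) :=
  compiso (compiso (compiso (compiso (symiso (assoc t' s' f)) (lwiso t' x))
    (assoc t' f1 s)) (rwiso y s)) (symiso (assoc f2 t s)).

Lemma vpaste_isoE (a a1 a2 b b1 b2 : C) (f : hom a b) (f1 : hom a1 b1)
    (f2 : hom a2 b2) (s : hom a a1) (s' : hom b b1) (t : hom a1 a2)
    (t' : hom b1 b2) (y : Iso (f2 · t) (t' · f1)) (x : Iso (f1 · s) (s' · f)) :
  iso_fwd (vpaste_iso y x) = vpaste y x.
Proof. by []. Qed.

Lemma vpaste_idsq (a b c : C) (t : hom b c) (s : hom a b) :
  vpaste (idsq t) (idsq s) = idsq (t · s).
Proof.
rewrite /vpaste /idsq.
apply: (@iso_epi _ _ _ (assoc (id1 c) t s)).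
apply: (@iso_mono _ _ _ (runit (t · s))).
va; rewrite iso_inv_fwd vcomp_id_r fwd_inv_k lunit_hcomp -runit_hcomp; va.
rewrite fwd_inv_k lwhisk_comp rwhisk_comp; va.
rewrite (reassoc1 (iso_fwd_inv (lwiso t (runit s)))) vcomp_id_l.
rewrite (reassoc1 (triangle t s)) -vcomp_assoc.
by rewrite (iso_fwd_inv (rwiso (runit t) s)) vcomp_id_l.
Qed.

Lemma inv_pentagon (a b c d e : C) (k : hom d e) (h : hom c d) (g : hom b c)
   (f : hom a b) :
  iso_inv (assoc k h (g · f)) ∘ ((k ◁ assoc h g f) ∘ assoc k (h · g) f)
  = assoc (k · h) g f ∘ (iso_inv (assoc k h g) ▷ f).
Proof.
apply: (@iso_mono _ _ _ (assoc k h (g · f))).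
apply: (@iso_epi _ _ _ (rwiso (assoc k h g) f)) => /=.
rewrite fwd_inv_k; va; rewrite (iso_inv_fwd (rwiso (assoc k h g) f)) vcomp_id_r.
by rewrite pentagon; va.
Qed.

Lemma pentagon3 (a b c d e : C) (k : hom d e) (h : hom c d) (g : hom b c)
   (f : hom a b) x (z : x ⇒ _) :
  (k ◁ assoc h g f) ∘ (assoc k (h · g) f ∘ ((assoc k h g ▷ f) ∘ z))
  = assoc k h (g · f) ∘ (assoc (k · h) g f ∘ z).
Proof. by rewrite -!vcomp_assoc pentagon. Qed.

Lemma inv_pentagon3 (a b c d e : C) (k : hom d e) (h : hom c d) (g : hom b c)
   (f : hom a b) x (z : x ⇒ _) :
  assoc (k · h) g f ∘ ((iso_inv (assoc k h g) ▷ f)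
    ∘ (iso_inv (assoc k (h · g) f) ∘ ((k ◁ iso_inv (assoc h g f)) ∘ z)))
  = iso_inv (assoc k h (g · f)) ∘ z.
Proof.
rewrite -(reassoc (inv_pentagon k h g f)) vcomp_assoc fwd_inv_k.
by rewrite (reassoc1 (iso_fwd_inv (lwiso k (assoc h g f)))) vcomp_id_l.
Qed.

Lemma paste_interchange (a b c a1 b1 c1 a2 b2 c2 : C)
    (f : hom a b) (g : hom b c) (f1 : hom a1 b1) (g1 : hom b1 c1)
    (f2 : hom a2 b2) (g2 : hom b2 c2)
    (sa : hom a a1) (sb : hom b b1) (sc : hom c c1)
    (ta : hom a1 a2) (tb : hom b1 b2) (tc : hom c1 c2)
    (xf : f1 · sa ⇒ sb · f) (xg : g1 · sb ⇒ sc · g)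
    (yf : f2 · ta ⇒ tb · f1) (yg : g2 · tb ⇒ tc · g1) :
  vpaste (hpaste yg yf) (hpaste xg xf) = hpaste (vpaste yg xg) (vpaste yf xf).
Proof.
apply: (@iso_mono _ _ _ (assoc tc sc (g · f))).
apply: (@iso_epi _ _ _ (assoc (g2 · f2) ta sa)).
rewrite /vpaste /hpaste !lwhisk_comp !rwhisk_comp; va.
rewrite fwd_inv_k iso_inv_fwd vcomp_id_r.
rewrite (reassoc (pentagon tc sc g f)); va.
rewrite (reassoc1 (iso_fwd_inv (rwiso (assoc tc sc g) f))) vcomp_id_l.
congr vcomp.
rewrite (reassoc (assoc_nat_m tc xg f)); congr vcomp.
apply: (@iso_mono _ _ _ (lwiso tc (assoc g1 sb f))) => /=.
rewrite (reassoc1 (iso_fwd_inv (lwiso tc (assoc g1 sb f)))) vcomp_id_l.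
rewrite !pentagon3 (reassoc (assoc_nat_l yg sb f)) inv_pentagon3.
rewrite (reassoc (inv_swap (assoc_nat_r g2 tb xf))).
rewrite (reassoc (assoc_nat_l yg f1 sa)).
rewrite -(reassoc (assoc_nat_r tc g1 xf)).
rewrite -(reassoc (interchange yg xf)).
do 3!congr vcomp.
rewrite -(reassoc (inv_pentagon g2 tb f1 sa)) vcomp_assoc.
congr vcomp; congr vcomp.
rewrite pentagon vcomp_assoc.
rewrite (reassoc1 (iso_inv_fwd (lwiso g2 (assoc f2 ta sa)))) vcomp_id_l.
by rewrite -(reassoc (assoc_nat_m g2 yf sa)).
Qed.

Definition idsq' (a b : C) (f : hom a b) : Iso (f · id1 a) (id1 b · f) :=
  compiso (symiso (lunit f)) (runit f).

Lemma hpaste_idsq (a b c : C) (g : hom b c) (f : hom a b) :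
  hpaste (idsq' g) (idsq' f) = idsq' (g · f).
Proof.
rewrite /hpaste /= rwhisk_comp lwhisk_comp; va.
rewrite -triangle; va.
rewrite (reassoc1 (iso_fwd_inv (assoc g (id1 b) f))) vcomp_id_l.
rewrite (reassoc1 (iso_fwd_inv (lwiso g (lunit f)))) vcomp_id_l.
rewrite runit_hcomp.
apply: (@iso_mono _ _ _ (lunit (g · f))).
rewrite fwd_inv_k (reassoc1 (lunit_hcomp g f)).
by rewrite (reassoc1 (iso_fwd_inv (rwiso (lunit g) f))) vcomp_id_l.
Qed.

Lemma vpaste_nat_src (a a1 a2 b b1 b2 : C) (f : hom a b) (f1 : hom a1 b1)
    (f2 f2' : hom a2 b2) (s : hom a a1) (s' : hom b b1) (t : hom a1 a2)
    (t' : hom b1 b2) (y : f2' · t ⇒ t' · f1) (x : f1 · s ⇒ s' · f)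
    (p : f2 ⇒ f2') :
  vpaste y x ∘ (p ▷ (t · s)) = vpaste (y ∘ (p ▷ t)) x.
Proof.
rewrite /vpaste; va; rewrite rwhisk_comp; va; do 4!congr vcomp.
by rewrite (inv_swap (assoc_nat_l p t s)).
Qed.

Lemma vpaste_nat_mid (a a1 a2 b b1 b2 : C) (f : hom a b) (f1 f1' : hom a1 b1)
    (f2 : hom a2 b2) (s : hom a a1) (s' : hom b b1) (t : hom a1 a2)
    (t' : hom b1 b2) (y : f2 · t ⇒ t' · f1) (x : f1' · s ⇒ s' · f)
    (p : f1 ⇒ f1') :
  vpaste ((t' ◁ p) ∘ y) x = vpaste y (x ∘ (p ▷ s)).
Proof.
rewrite /vpaste; va; rewrite rwhisk_comp lwhisk_comp; va; do 2!congr vcomp.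
by rewrite (reassoc (assoc_nat_m t' p s)).
Qed.

Lemma vpaste_nat_tgt (a a1 a2 b b1 b2 : C) (f f' : hom a b) (f1 : hom a1 b1)
    (f2 : hom a2 b2) (s : hom a a1) (s' : hom b b1) (t : hom a1 a2)
    (t' : hom b1 b2) (y : f2 · t ⇒ t' · f1) (x : f1 · s ⇒ s' · f)
    (p : f ⇒ f') :
  vpaste y ((s' ◁ p) ∘ x) = ((t' · s') ◁ p) ∘ vpaste y x.
Proof.
rewrite /vpaste; va; rewrite lwhisk_comp; va.
by rewrite (reassoc (inv_swap (assoc_nat_r t' s' p))).
Qed.

Context (F G H : Pseudofunctor B C).

Definition idpn : Pseudonat F F.
Proof.
exists (fun a => id1 (F a)) (fun a b f => idsq' (pf_hom F f)).
- move=> a b f f' x /=; va; rewrite runit_nat -!vcomp_assoc; congr vcomp.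
  by rewrite (inv_swap (lunit_nat _)).
- move=> a /=; va; rewrite runit_nat lunit_runit_id1 iso_inv_fwd vcomp_id_r.
  by rewrite (reassoc (inv_swap (lunit_nat _))) -lunit_runit_id1 iso_inv_fwd vcomp_id_r.
- move=> a b c g f; have := hpaste_idsq (pf_hom F g) (pf_hom F f).
  rewrite /hpaste; va => -> /=; va; rewrite runit_nat.
  by rewrite (reassoc (inv_swap (lunit_nat _))).
Defined.

Definition comppn (t : Pseudonat G H) (s : Pseudonat F G) : Pseudonat F H.
Proof.
exists (fun a => t a · s a) (fun a b f => vpaste_iso (pn_hom t f) (pn_hom s f)).
- move=> a b f f' x; rewrite vpaste_isoE vpaste_nat_src pn_nat vpaste_nat_mid.
  by rewrite pn_nat vpaste_nat_tgt.
- move=> a; rewrite vpaste_isoE vpaste_nat_src pn_id vcomp_assoc vpaste_nat_mid.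
  by rewrite pn_id vcomp_assoc vpaste_nat_tgt vpaste_idsq /idsq; va.
- move=> a b c g f; rewrite vpaste_isoE vpaste_nat_src pn_comp; va.
  rewrite vpaste_nat_mid pn_comp; va; rewrite vpaste_nat_tgt.
  have := paste_interchange (pn_hom s f) (pn_hom s g) (pn_hom t f) (pn_hom t g).
  by rewrite /hpaste; va => ->.
Defined.
End PseudonatOps.

(* Equivalence of [F] and [G] as objects of the bicategory of pseudofunctors from
   [B] to [C]. *)
Definition pseudonat_equivalent (B C : Bicategory) (F G : Pseudofunctor B C) : Prop :=
  exists (s : Pseudonat F G) (t : Pseudonat G F),
    (exists m : Modification (comppn t s) (idpn F), forall a, is_invertible (m a)) /\
    (exists m : Modification (comppn s t) (idpn G), forall a, is_invertible (m a)).

Definition biequivalent (B C : Bicategory) : Prop :=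
  exists (F : Pseudofunctor B C) (G : Pseudofunctor C B),
    pseudonat_equivalent (comppf G F) (idpf B) /\
    pseudonat_equivalent (comppf F G) (idpf C).

(* In the axioms below, the associators and unitors of [E] that are usually left
   implicit are written out. *)
Record RelPseudomonad (A E : Bicategory) (J : Pseudofunctor A E) := {
  rp_ob :> A -> E;
  rp_ext : forall {X Y : A}, Functor (hom (J X) (rp_ob Y)) (hom (rp_ob X) (rp_ob Y));
  rp_unit : forall X : A, hom (J X) (rp_ob X);
  rp_mu : forall {X Y Z : A} (g : hom (J Y) (rp_ob Z)) (f : hom (J X) (rp_ob Y)),
    Iso (rp_ext (rp_ext g · f)) (rp_ext g · rp_ext f);
  rp_eta : forall {X Y : A} (f : hom (J X) (rp_ob Y)), Iso f (rp_ext f · rp_unit X);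
  rp_theta : forall X : A, Iso (rp_ext (rp_unit X)) (id1 (rp_ob X));
  rp_mu_nat_l : forall (X Y Z : A) (g g' : hom (J Y) (rp_ob Z)) (y : g ⇒ g')
      (f : hom (J X) (rp_ob Y)),
    rp_mu g' f ∘ fmap rp_ext (fmap rp_ext y ▷ f)
    = (fmap rp_ext y ▷ rp_ext f) ∘ rp_mu g f;
  rp_mu_nat_r : forall (X Y Z : A) (g : hom (J Y) (rp_ob Z))
      (f f' : hom (J X) (rp_ob Y)) (x : f ⇒ f'),
    rp_mu g f' ∘ fmap rp_ext (rp_ext g ◁ x)
    = (rp_ext g ◁ fmap rp_ext x) ∘ rp_mu g f;
  rp_eta_nat : forall (X Y : A) (f f' : hom (J X) (rp_ob Y)) (x : f ⇒ f'),
    rp_eta f' ∘ x = (fmap rp_ext x ▷ rp_unit X) ∘ rp_eta f;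
  rp_mult : forall (W X Y Z : A) (h : hom (J Y) (rp_ob Z))
      (g : hom (J X) (rp_ob Y)) (f : hom (J W) (rp_ob X)),
    assoc (rp_ext h) (rp_ext g) (rp_ext f)
      ∘ (rp_mu h g ▷ rp_ext f) ∘ rp_mu (rp_ext h · g) f
    = (rp_ext h ◁ rp_mu g f) ∘ rp_mu h (rp_ext g · f)
      ∘ fmap rp_ext (assoc (rp_ext h) (rp_ext g) f ∘ (rp_mu h g ▷ f));
  rp_unital : forall (X Y : A) (f : hom (J X) (rp_ob Y)),
    (rp_ext f ◁ rp_theta X) ∘ rp_mu f (rp_unit X) ∘ fmap rp_ext (rp_eta f)
    = iso_inv (runit (rp_ext f))
}.
Arguments rp_ext {_ _ _} _ {_ _}.
Arguments rp_unit {_ _ _} _ _.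
Arguments rp_mu {_ _ _} _ {_ _ _} _ _.
Arguments rp_eta {_ _ _} _ {_ _} _.
Arguments rp_theta {_ _ _} _ _.

Section Algebras.
Context (A E : Bicategory) (J : Pseudofunctor A E) (T : RelPseudomonad J).

Record Pseudoalgebra := {
  pa_ob :> E;
  pa_ext : forall {X : A}, Functor (hom (J X) pa_ob) (hom (T X) pa_ob);
  pa_hat : forall {X Y : A} (g : hom (J Y) pa_ob) (f : hom (J X) (T Y)),
    Iso (pa_ext (pa_ext g · f)) (pa_ext g · rp_ext T f);
  pa_tilde : forall {X : A} (f : hom (J X) pa_ob), Iso f (pa_ext f · rp_unit T X);
  pa_hat_nat_l : forall (X Y : A) (g g' : hom (J Y) pa_ob) (y : g ⇒ g')
      (f : hom (J X) (T Y)),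
    pa_hat g' f ∘ fmap pa_ext (fmap pa_ext y ▷ f)
    = (fmap pa_ext y ▷ rp_ext T f) ∘ pa_hat g f;
  pa_hat_nat_r : forall (X Y : A) (g : hom (J Y) pa_ob)
      (f f' : hom (J X) (T Y)) (x : f ⇒ f'),
    pa_hat g f' ∘ fmap pa_ext (pa_ext g ◁ x)
    = (pa_ext g ◁ fmap (rp_ext T) x) ∘ pa_hat g f;
  pa_tilde_nat : forall (X : A) (f f' : hom (J X) pa_ob) (x : f ⇒ f'),
    pa_tilde f' ∘ x = (fmap pa_ext x ▷ rp_unit T X) ∘ pa_tilde f;
  pa_mult : forall (X Y Z : A) (h : hom (J Z) pa_ob) (g : hom (J Y) (T Z))
      (f : hom (J X) (T Y)),
    assoc (pa_ext h) (rp_ext T g) (rp_ext T f)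
      ∘ (pa_hat h g ▷ rp_ext T f) ∘ pa_hat (pa_ext h · g) f
    = (pa_ext h ◁ rp_mu T g f) ∘ pa_hat h (rp_ext T g · f)
      ∘ fmap pa_ext (assoc (pa_ext h) (rp_ext T g) f ∘ (pa_hat h g ▷ f));
  pa_unital : forall (X : A) (f : hom (J X) pa_ob),
    (pa_ext f ◁ rp_theta T X) ∘ pa_hat f (rp_unit T X) ∘ fmap pa_ext (pa_tilde f)
    = iso_inv (runit (pa_ext f))
}.
Arguments pa_ext _ {_}.
Arguments pa_hat _ {_ _} _ _.
Arguments pa_tilde _ {_} _.

Record Pseudomorphism (M N : Pseudoalgebra) := {
  pm_hom :> hom (pa_ob M) (pa_ob N);
  pm_bar : forall {X : A} (f : hom (J X) M),
    Iso (pa_ext N (pm_hom · f)) (pm_hom · pa_ext M f);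
  pm_nat : forall (X : A) (f f' : hom (J X) M) (x : f ⇒ f'),
    pm_bar f' ∘ fmap (pa_ext N) (pm_hom ◁ x)
    = (pm_hom ◁ fmap (pa_ext M) x) ∘ pm_bar f;
  pm_mult : forall (X Y : A) (g : hom (J Y) M) (f : hom (J X) (T Y)),
    (pm_hom ◁ pa_hat M g f) ∘ pm_bar (pa_ext M g · f)
      ∘ fmap (pa_ext N) (assoc pm_hom (pa_ext M g) f ∘ (pm_bar g ▷ f))
    = assoc pm_hom (pa_ext M g) (rp_ext T f)
      ∘ (pm_bar g ▷ rp_ext T f) ∘ pa_hat N (pm_hom · g) f;
  pm_unital : forall (X : A) (f : hom (J X) M),
    assoc pm_hom (pa_ext M f) (rp_unit T X)
      ∘ (pm_bar f ▷ rp_unit T X) ∘ pa_tilde N (pm_hom · f)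
    = pm_hom ◁ pa_tilde M f
}.
Arguments pm_bar {_ _} _ {_} _.

Definition is_transformation (M N : Pseudoalgebra) (h h' : Pseudomorphism M N)
    (x : pm_hom h ⇒ pm_hom h') : Prop :=
  forall (X : A) (f : hom (J X) M),
    pm_bar h' f ∘ fmap (pa_ext N) (x ▷ f) = (x ▷ pa_ext M f) ∘ pm_bar h f.

Definition Transformation (M N : Pseudoalgebra) (h h' : Pseudomorphism M N) : Type :=
  { x : pm_hom h ⇒ pm_hom h' | is_transformation x }.

Lemma transf_ext (M N : Pseudoalgebra) (h h' : Pseudomorphism M N)
  (x y : Transformation h h') : proj1_sig x = proj1_sig y -> x = y.
Proof.
case: x y => [x p] [y q] /= e; subst y; congr exist; exact: proof_irrelevance.
Qed.

Definition transf_id (M N : Pseudoalgebra) (h : Pseudomorphism M N) :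
  Transformation h h.
Proof.
exists (idarr (pm_hom h)) => X f.
by rewrite !rwhisk_id fmap_id vcomp_id_l vcomp_id_r.
Defined.

Definition transf_comp (M N : Pseudoalgebra) (h h' h'' : Pseudomorphism M N)
    (y : Transformation h' h'') (x : Transformation h h') : Transformation h h''.
Proof.
exists (proj1_sig y ∘ proj1_sig x) => X f; case: x y => [x Hx] [y Hy] /=.
by rewrite !rwhisk_comp fmap_comp -vcomp_assoc Hy vcomp_assoc Hx; va.
Defined.

Definition PsAlg_hom (M N : Pseudoalgebra) : Category.
Proof.
exists (Pseudomorphism M N) (@Transformation M N) (@transf_id M N) (@transf_comp M N).
all: by move=> *; apply: transf_ext; rewrite /= ?vcomp_id_l ?vcomp_id_r ?vcomp_assoc.
Defined.

Definition transf_iso (M N : Pseudoalgebra) (h h' : Pseudomorphism M N)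
    (i : Iso (pm_hom h) (pm_hom h')) (H : is_transformation i) :
  @Iso (PsAlg_hom M N) h h'.
Proof.
unshelve eexists (exist _ (iso_fwd i) H) (exist _ (iso_inv i) _).
- move=> X f; apply: (@iso_mono _ _ _ (rwiso i (pa_ext M f))) => /=.
  rewrite -vcomp_assoc -H vcomp_assoc -fmap_comp.
  rewrite (iso_fwd_inv (rwiso i f)) fmap_id vcomp_id_r -vcomp_assoc.
  by rewrite (iso_fwd_inv (rwiso i (pa_ext M f))) vcomp_id_l.
- by apply: transf_ext; apply: iso_inv_fwd.
- by apply: transf_ext; apply: iso_fwd_inv.
Defined.

Definition pm_id (M : Pseudoalgebra) : Pseudomorphism M M.
Proof.
exists (id1 (pa_ob M))
  (fun X f => compiso (symiso (lunit (pa_ext M f))) (fmapiso (pa_ext M) (lunit f))) => /=.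
- move=> X f f' x; va; rewrite -fmap_comp lunit_nat fmap_comp -!vcomp_assoc.
  by rewrite (inv_swap (lunit_nat _)).
- move=> X Y g f; va.
  rewrite -(reassoc (inv_swap (lunit_nat _))) -fmap_comp.
  rewrite (reassoc1 (lunit_hcomp _ _)) -rwhisk_comp fwd_inv_k pa_hat_nat_l.
  apply: (@iso_mono _ _ _ (lunit (pa_ext M g · rp_ext T f))).
  rewrite fwd_inv_k (reassoc1 (lunit_hcomp _ _)) -vcomp_assoc -rwhisk_comp.
  by rewrite fwd_inv_k.
- move=> X f; rewrite rwhisk_comp; va.
  apply: (@iso_mono _ _ _ (lunit (pa_ext M f · rp_unit T X))).
  rewrite (reassoc1 (lunit_hcomp _ _)) lunit_nat pa_tilde_nat.
  by rewrite (reassoc1 (iso_fwd_inv (rwiso (lunit (pa_ext M f)) _))) vcomp_id_l.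
Defined.

Definition pm_comp (M N P : Pseudoalgebra) (k : Pseudomorphism N P)
    (h : Pseudomorphism M N) : Pseudomorphism M P.
Proof.
exists (pm_hom k · pm_hom h)
  (fun X f => compiso (compiso (compiso (symiso (assoc k h (pa_ext M f)))
     (lwiso k (pm_bar h f))) (pm_bar k (h · f))) (fmapiso (pa_ext P) (assoc k h f))) => /=.
- move=> X f f' x; va.
  rewrite -fmap_comp assoc_nat_r fmap_comp (reassoc (pm_nat _ _)).
  rewrite -(reassoc (inv_swap (assoc_nat_r _ _ _))); congr vcomp.
  rewrite -!vcomp_assoc; do 2!congr vcomp.
  by rewrite -lwhisk_comp pm_nat lwhisk_comp.
- move=> X Y g f; va.
  rewrite -(reassoc (inv_swap (assoc_nat_r _ _ _))) -fmap_comp.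
  rewrite !rwhisk_comp; va.
  rewrite -(reassoc (inv_pentagon k h (pa_ext M g) f)) fwd_inv_k; va.
  rewrite (reassoc (assoc_nat_m _ _ _)).
  rewrite (lwhisk_comp_k (assoc _ _ _)) fmap_comp.
  rewrite (reassoc (pm_nat _ _)).
  rewrite !lwhisk_comp_k pm_mult !lwhisk_comp; va.
  rewrite -(reassoc (inv_pentagon k h (pa_ext M g) _)); va.
  rewrite (reassoc (assoc_nat_m _ _ _)); do 3!congr vcomp.
  rewrite -pa_hat_nat_l fmap_comp.
  have := f_equal (fun z => z ∘ fmap (pa_ext P) (fmap (pa_ext P) (assoc k h g) ▷ f))
    (pm_mult k (h · g) f).
  by rewrite /= !fmap_comp; va.
- move=> X f; rewrite !rwhisk_comp; va.
  rewrite -pa_tilde_nat -(reassoc (inv_pentagon k h (pa_ext M f) _)); va.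
  rewrite (reassoc (assoc_nat_m _ _ _)).
  rewrite (reassoc13 (pm_unital k (h · f))).
  rewrite !lwhisk_comp_k pm_unital -assoc_nat_r.
  by rewrite inv_fwd_k.
Defined.

Definition transf_lwhisk (M N P : Pseudoalgebra) (k : Pseudomorphism N P)
    (h h' : Pseudomorphism M N) (x : Transformation h h') :
  Transformation (pm_comp k h) (pm_comp k h').
Proof.
exists (pm_hom k ◁ proj1_sig x) => X f; case: x => [x Hx] /=; va.
rewrite -fmap_comp assoc_nat_m fmap_comp (reassoc (pm_nat _ _)).
rewrite lwhisk_comp_k Hx lwhisk_comp; va.
by rewrite (reassoc (inv_swap (assoc_nat_m _ _ _))).
Defined.

Definition transf_rwhisk (M N P : Pseudoalgebra) (k k' : Pseudomorphism N P)
    (y : Transformation k k') (h : Pseudomorphism M N) :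
  Transformation (pm_comp k h) (pm_comp k' h).
Proof.
exists (proj1_sig y ▷ pm_hom h) => X f; case: y => [y Hy] /=; va.
rewrite -fmap_comp assoc_nat_l fmap_comp (reassoc (Hy _ _)).
by rewrite -(reassoc (interchange _ _)) (reassoc (inv_swap (assoc_nat_l _ _ _))).
Defined.

Lemma is_transf_assoc (M N P Q : Pseudoalgebra) (l : Pseudomorphism P Q)
    (k : Pseudomorphism N P) (h : Pseudomorphism M N) :
  @is_transformation _ _ (pm_comp (pm_comp l k) h) (pm_comp l (pm_comp k h))
    (assoc (pm_hom l) (pm_hom k) (pm_hom h)).
Proof.
move=> X f /=; rewrite !lwhisk_comp; va.
rewrite -(reassoc (pm_nat _ _)) -!fmap_comp.
have := pentagon l k h f; rewrite vcomp_assoc => <-.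
rewrite -(reassoc (inv_swap (assoc_nat_r _ _ _))).
rewrite fmap_comp.
apply: (@iso_mono _ _ _ (assoc l (pm_hom k · h) (pa_ext M f))).
apply: (@iso_mono _ _ _ (lwiso l (assoc k h (pa_ext M f)))).
rewrite fwd_inv_k /= pentagon3 fwd_inv_k fwd_inv_k.
by rewrite (reassoc1 (iso_fwd_inv (lwiso l (assoc k h (pa_ext M f))))) vcomp_id_l.
Qed.

Lemma is_transf_lunit (M N : Pseudoalgebra) (h : Pseudomorphism M N) :
  @is_transformation _ _ (pm_comp (pm_id N) h) h (lunit (pm_hom h)).
Proof.
move=> X f /=; va.
rewrite -fmap_comp lunit_hcomp.
rewrite -(reassoc (inv_swap (lunit_nat _))) -(lunit_hcomp h (pa_ext M f)).
by va; rewrite fwd_inv_k fwd_inv_k.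
Qed.

Lemma is_transf_runit (M N : Pseudoalgebra) (h : Pseudomorphism M N) :
  @is_transformation _ _ (pm_comp h (pm_id M)) h (runit (pm_hom h)).
Proof.
move=> X f /=; rewrite !lwhisk_comp; va.
rewrite -(reassoc (pm_nat _ _)) -fmap_comp triangle -(triangle h (pa_ext M f)); va.
rewrite fwd_inv_k (reassoc1 (iso_fwd_inv (lwiso h (lunit (pa_ext M f))))).
by rewrite vcomp_id_l.
Qed.

Definition PsAlg : Bicategory.
Proof.
exists Pseudoalgebra PsAlg_hom pm_id (fun M N P k h => pm_comp k h)
  (fun M N P k h h' x => transf_lwhisk k x)
  (fun M N P k k' y h => transf_rwhisk y h)
  (fun M N P Q l k h => transf_iso (is_transf_assoc l k h))
  (fun M N h => transf_iso (is_transf_lunit h))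
  (fun M N h => transf_iso (is_transf_runit h)).
all: move=> *; apply: transf_ext => /=.
- exact: lwhisk_id.
- exact: lwhisk_comp.
- exact: rwhisk_id.
- exact: rwhisk_comp.
- exact: interchange.
- exact: assoc_nat_l.
- exact: assoc_nat_m.
- exact: assoc_nat_r.
- exact: lunit_nat.
- exact: runit_nat.
- exact: triangle.
- exact: pentagon.
Defined.

Definition free_pseudoalgebra (X : A) : Pseudoalgebra := {|
  pa_ob := T X;
  pa_ext := fun Y => @rp_ext A E J T Y X;
  pa_hat := fun Y Z g f => rp_mu T g f;
  pa_tilde := fun Y f => rp_eta T f;
  pa_hat_nat_l := fun Y Z g g' y f => rp_mu_nat_l y f;
  pa_hat_nat_r := fun Y Z g f f' x => rp_mu_nat_r g x;
  pa_tilde_nat := fun Y f f' x => rp_eta_nat x;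
  pa_mult := fun W Y Z h g f => rp_mult h g f;
  pa_unital := fun Y f => rp_unital f
|}.

Lemma psmor_eq (M N : Pseudoalgebra) (h h' : Pseudomorphism M N)
    (i : Transformation h h') (e : pm_hom h = pm_hom h') :
  proj1_sig i = id_cast e ->
  exists e' : h = h', i = @id_cast (PsAlg_hom M N) h h' e'.
Proof.
case: i => [i Hi] /= Ei.
have Eh : h = h'.
  case: h e i Hi Ei => [h hb p1 p2 p3]; case: h' => [h' hb' q1 q2 q3] /= e.
  subst h' => i Hi /= Ei; subst i.
  have Eb : hb = hb'.
    apply: functional_extensionality_dep => X.
    apply: functional_extensionality_dep => f; apply: iso_ext.
    by have := Hi X f; rewrite /= !rwhisk_id fmap_id vcomp_id_l vcomp_id_r.
  by subst hb'; congr Build_Pseudomorphism; exact: proof_irrelevance.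
exists Eh; subst h'; apply: transf_ext => /=; rewrite Ei.
by rewrite (proof_irrelevance _ e eq_refl).
Qed.

Lemma PsAlg_2category : Is2Category E -> Is2Category PsAlg.
Proof.
case=> Ha Hl Hr; split.
- move=> M N P Q l k h; have [e He] := Ha _ _ _ _ (pm_hom l) (pm_hom k) (pm_hom h).
  exact: (@psmor_eq _ _ (pm_comp (pm_comp l k) h) (pm_comp l (pm_comp k h))
    (iso_fwd (transf_iso (is_transf_assoc l k h))) e He).
- move=> M N h; have [e He] := Hl _ _ (pm_hom h).
  exact: (@psmor_eq _ _ (pm_comp (pm_id N) h) h
    (iso_fwd (transf_iso (is_transf_lunit h))) e He).
- move=> M N h; have [e He] := Hr _ _ (pm_hom h).
  exact: (@psmor_eq _ _ (pm_comp h (pm_id M)) h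
    (iso_fwd (transf_iso (is_transf_runit h))) e He).
Qed.
End Algebras.

(* The full and locally full sub-bicategory of [B] on the objects [F x], with
   [F x] and [F y] kept distinct when [x] and [y] are. *)
Definition full_image (I : Type) (B : Bicategory) (F : I -> B) : Bicategory.
Proof.
exists I (fun x y => hom (F x) (F y)) (fun x => id1 (F x))
  (fun x y z g f => g · f)
  (fun x y z g f f' a => g ◁ a) (fun x y z g g' b f => b ▷ f)
  (fun w x y z h g f => assoc h g f) (fun x y f => lunit f) (fun x y f => runit f).
all: move=> *.
- exact: lwhisk_id.
- exact: lwhisk_comp.
- exact: rwhisk_id.
- exact: rwhisk_comp.
- exact: interchange.
- exact: assoc_nat_l.
- exact: assoc_nat_m.
- exact: assoc_nat_r.
- exact: lunit_nat.
- exact: runit_nat.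
- exact: triangle.
- exact: pentagon.
Defined.

Lemma full_image_2category (I : Type) (B : Bicategory) (F : I -> B) :
  Is2Category B -> Is2Category (full_image F).
Proof.
case=> Ha Hl Hr; split.
- by move=> w x y z h g f; exact: (Ha _ _ _ _ h g f).
- by move=> x y f; exact: (Hl _ _ f).
- by move=> x y f; exact: (Hr _ _ f).
Qed.

Section FreeAndKleisli.
Context (A E : Bicategory) (J : Pseudofunctor A E) (T : RelPseudomonad J).

(* Only the action of the free-pseudoalgebra pseudofunctor on objects matters for
   its full image. *)
Definition ImF : Bicategory := full_image (fun X : A => free_pseudoalgebra T X : PsAlg T).

Lemma ImF_2category : Is2Category E -> Is2Category ImF.
Proof. by move=> HE; apply/full_image_2category/PsAlg_2category. Qed.

Definition Kl : Bicategory.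
Proof.
exists A (fun X Y => hom (J X) (T Y)) (fun X => rp_unit T X)
  (fun X Y Z g f => rp_ext T g · f)
  (fun X Y Z g f f' x => rp_ext T g ◁ x)
  (fun X Y Z g g' y f => fmap (rp_ext T) y ▷ f)
  (fun W X Y Z h g f =>
     compiso (assoc (rp_ext T h) (rp_ext T g) f) (rwiso (rp_mu T h g) f))
  (fun X Y f => compiso (lunit f) (rwiso (rp_theta T Y) f))
  (fun X Y f => symiso (rp_eta T f)) => /=.
- by move=> *; apply: lwhisk_id.
- by move=> *; apply: lwhisk_comp.
- by move=> *; rewrite fmap_id rwhisk_id.
- by move=> *; rewrite fmap_comp rwhisk_comp.
- by move=> *; apply: interchange.
- by move=> *; rewrite vcomp_assoc -rwhisk_comp rp_mu_nat_l rwhisk_comp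
                       -!vcomp_assoc assoc_nat_l.
- by move=> *; rewrite vcomp_assoc -rwhisk_comp rp_mu_nat_r rwhisk_comp
                       -!vcomp_assoc assoc_nat_m.
- by move=> *; rewrite vcomp_assoc interchange -!vcomp_assoc assoc_nat_r.
- by move=> *; rewrite vcomp_assoc interchange -!vcomp_assoc lunit_nat.
- by move=> *; rewrite (inv_swap (rp_eta_nat _)).
- move=> X Y Z g f; rewrite lwhisk_comp; va.
  rewrite -(reassoc (assoc_nat_m _ _ _)) (reassoc1 (triangle _ _)).
  rewrite -!rwhisk_comp; apply: (f_equal (fun z => z ▷ f)).
  apply: (@iso_epi _ _ _ (fmapiso (rp_ext T) (rp_eta T g))) => /=.
  rewrite -fmap_comp iso_inv_fwd fmap_id !vcomp_assoc.
  by have := rp_unital g; rewrite !vcomp_assoc => ->; rewrite iso_fwd_inv.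
- move=> V W X Y Z k h g f; rewrite lwhisk_comp; va.
  rewrite -(reassoc (assoc_nat_l _ _ _)) -pentagon3.
  rewrite -(reassoc (assoc_nat_m _ _ _)); do 2!congr vcomp.
  by have := f_equal (fun z => z ▷ f) (rp_mult k h g); rewrite /= !rwhisk_comp; va.
Defined.
End FreeAndKleisli.

(* Main.v *)
From Stdlib Require Import ssreflect.
Require Import Defs.

(** Restriction along the unit, [h |-> h · i_X], sends a pseudomorphism out of the
    free pseudoalgebra on [X] to a 1-cell out of [J X]; extension,
    [f |-> (f^*, mu_{f,-})], goes back.  Both are the identity on objects, and the
    theorem says that they are mutually inverse up to isomorphism, compatibly with
    composition.

    One composite is compared with the identity by [eta_f : f => f^* i].  The other
    is compared by the composite
      (h i)^* => h i^* => h 1 => h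
    of the structure cell of [h] at [i], of [theta], and of a unitor
    ([extension_iso]).  This comparison is natural in [h]
    ([extension_iso_nat]), is a transformation of pseudomorphisms
    ([extension_iso_transf]), and respects identities and composition
    ([extension_iso_id], [extension_iso_comp]).  It also supplies the
    compositor of the restriction pseudofunctor: [(h i)^* (g i) => h (g i)].

    The two axioms of a relative pseudomonad do not mention three unit laws that
    are needed throughout: how [mu] interacts with [theta] on the left
    ([mu_unit_l]) and with [eta] ([mu_eta]), and that [theta] and [eta] agree on the
    unit ([theta_eta]).  They follow from the given axioms just as, in a monoidal
    category, the other unit coherences follow from the triangle and the pentagon.
    The last two are literally the redundant coherence laws of the Kleisli
    bicategory; the first needs the same argument carried out before whiskering.

    Finally, both comparisons relate pseudofunctors that have the same action on
    objects, by 2-cells only.  Such data (an invertible icon) give an equivalence of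
    pseudofunctors with identity 1-cells as components ([icon_equivalent]). *)

Set Implicit Arguments.
Unset Strict Implicit.
Unset Printing Implicit Defensive.
Local Open Scope bicat_scope.

(** * Squares with identity sides *)

Section UnitSquares.
Context (C : Bicategory).

(** A 2-cell seen as a square whose two vertical sides are identities: this is what
    an icon contributes as the naturality cell of a pseudonatural transformation. *)
Definition unit_square (a b : C) (f f' : hom a b) (x : f' ⇒ f) :
    f' · id1 a ⇒ id1 b · f :=
  idsq' f ∘ (x ▷ id1 a).

Lemma unit_squareE (a b : C) (f f' : hom a b) (x : f' ⇒ f) :
  unit_square x = (id1 b ◁ x) ∘ idsq' f'.
Proof.
rewrite /unit_square /=; va; rewrite runit_nat.
by rewrite (reassoc (inv_swap (lunit_nat _))).
Qed.

Lemma unit_square_src (a b : C) (f f' f'' : hom a b) (x : f' ⇒ f) (y : f'' ⇒ f') :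
  unit_square x ∘ (y ▷ id1 a) = unit_square (x ∘ y).
Proof. by rewrite /unit_square rwhisk_comp; va. Qed.

Lemma unit_square_tgt (a b : C) (f f' f'' : hom a b) (x : f' ⇒ f) (y : f ⇒ f'') :
  (id1 b ◁ y) ∘ unit_square x = unit_square (y ∘ x).
Proof. by rewrite !unit_squareE lwhisk_comp; va. Qed.

(** Horizontal pasting becomes horizontal composition of 2-cells: move [y] and [x]
    to the outside, where the remaining pasting of structural squares is
    [hpaste_idsq]. *)
Lemma hpaste_unit_square (a b c : C) (g g' : hom b c) (f f' : hom a b)
    (y : g' ⇒ g) (x : f' ⇒ f) :
  hpaste (unit_square y) (unit_square x) = unit_square ((y ▷ f) ∘ (g' ◁ x)).
Proof.
rewrite -unit_square_tgt.
have -> : unit_square (g' ◁ x) = idsq' (g' · f) ∘ ((g' ◁ x) ▷ id1 a) by [].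
rewrite -hpaste_idsq [unit_square y]unit_squareE /unit_square /hpaste.
rewrite !rwhisk_comp !lwhisk_comp; va.
by rewrite assoc_nat_m (reassoc (assoc_nat_m _ _ _)).
Qed.

(** Only structural cells occur: [triangle] removes the two inverse associators and
    [runit_hcomp] the associator between them. *)
Lemma vpaste_idsq' (a b : C) (f : hom a b) :
  (lunit (id1 b) ▷ f) ∘ vpaste (idsq' f) (idsq' f)
  = idsq' f ∘ (f ◁ lunit (id1 a)).
Proof.
rewrite /vpaste /= lwhisk_comp rwhisk_comp; va.
rewrite lunit_runit_id1 -triangle; va.
rewrite fwd_inv_k (reassoc1 (iso_fwd_inv (lwiso _ (lunit f)))) vcomp_id_l.
rewrite -triangle; va; rewrite iso_fwd_inv vcomp_id_r.
by rewrite (reassoc1 (runit_hcomp _ _)) (reassoc (runit_nat _)).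
Qed.

(** Vertical pasting becomes vertical composition.  The sides of the pasted square
    are [id1 · id1], so the comparison with a unit square goes through a unitor; that
    unitor will be the component of a modification. *)
Lemma vpaste_unit_square (a b : C) (f f' f'' : hom a b) (y : f'' ⇒ f') (x : f' ⇒ f) :
  (lunit (id1 b) ▷ f) ∘ vpaste (unit_square y) (unit_square x)
  = unit_square (x ∘ y) ∘ (f'' ◁ lunit (id1 a)).
Proof.
rewrite [unit_square x]unit_squareE vpaste_nat_tgt.
have -> : unit_square y = idsq' f' ∘ (y ▷ id1 a) by [].
rewrite -vpaste_nat_src (reassoc (interchange _ _)) (reassoc (vpaste_idsq' f')).
by rewrite -interchange -unit_square_tgt /unit_square; va.
Qed.

Lemma unit_square_id (a b : C) (f : hom a b) : unit_square (idarr f) = idsq' f.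
Proof. by rewrite /unit_square rwhisk_id vcomp_id_r. Qed.
End UnitSquares.

(** * Invertible icons are equivalences *)

Section Icons.
Context (B C : Bicategory).

(** [F] and [G] must share the object map [o] for [u] to have a type, hence the
    explicit structure of both. *)
Definition icon_pseudonat o HF iF cF f1 f2 f3 f4 f5 HG iG cG g1 g2 g3 g4 g5
    (F := @Build_Pseudofunctor B C o HF iF cF f1 f2 f3 f4 f5)
    (G := @Build_Pseudofunctor B C o HG iG cG g1 g2 g3 g4 g5)
    (u : forall (a b : B) (f : hom a b), Iso (HG a b f) (HF a b f))
    (u_nat : forall (a b : B) (f f' : hom a b) (x : f ⇒ f'),
      u a b f' ∘ fmap (HG a b) x = fmap (HF a b) x ∘ u a b f)
    (u_id : forall a : B, u a a (id1 a) ∘ iG a = iF a)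
    (u_comp : forall (a b c : B) (g : hom b c) (f : hom a b),
      u a c (g · f) ∘ cG a b c g f
      = cF a b c g f ∘ ((u b c g ▷ HF a b f) ∘ (HG b c g ◁ u a b f))) :
  Pseudonat F G.
Proof.
exists (fun a => id1 (o a) : hom (F a) (G a))
  (fun a b f => compiso (idsq' (HF a b f)) (rwiso (u a b f) (id1 (o a)))).
- by move=> a b f f' x; rewrite [LHS]unit_square_src [RHS]unit_square_tgt u_nat.
- move=> a; rewrite [LHS]unit_square_src u_id vcomp_assoc [LHS]unit_squareE.
  by rewrite /= lunit_runit_id1 iso_inv_fwd -lunit_runit_id1 iso_inv_fwd.
- move=> a b c g f; rewrite [LHS]unit_square_src u_comp -unit_square_tgt.
  by rewrite -hpaste_unit_square /hpaste !vcomp_assoc.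
Defined.

(** The inverse 2-cells form an icon as well, and both composites of the two
    transformations have naturality cells that paste to identities. *)
Lemma icon_equivalent o HF iF cF f1 f2 f3 f4 f5 HG iG cG g1 g2 g3 g4 g5
    (F := @Build_Pseudofunctor B C o HF iF cF f1 f2 f3 f4 f5)
    (G := @Build_Pseudofunctor B C o HG iG cG g1 g2 g3 g4 g5)
    (u : forall (a b : B) (f : hom a b), Iso (HG a b f) (HF a b f))
    (u_nat : forall (a b : B) (f f' : hom a b) (x : f ⇒ f'),
      u a b f' ∘ fmap (HG a b) x = fmap (HF a b) x ∘ u a b f)
    (u_id : forall a : B, u a a (id1 a) ∘ iG a = iF a)
    (u_comp : forall (a b c : B) (g : hom b c) (f : hom a b),
      u a c (g · f) ∘ cG a b c g f
      = cF a b c g f ∘ ((u b c g ▷ HF a b f) ∘ (HG b c g ◁ u a b f))) :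
  pseudonat_equivalent F G.
Proof.
have v_nat a b (f f' : hom a b) (x : f ⇒ f') :
    symiso (u a b f') ∘ fmap (HF a b) x = fmap (HG a b) x ∘ symiso (u a b f).
  by rewrite (inv_swap (u_nat _ _ _ _ _)).
have v_id a : symiso (u a a (id1 a)) ∘ iF a = iG a.
  by rewrite -u_id /= inv_fwd_k.
have v_comp a b c (g : hom b c) (f : hom a b) :
    symiso (u a c (g · f)) ∘ cF a b c g f
    = cG a b c g f ∘ ((symiso (u b c g) ▷ HG a b f) ∘ (HF b c g ◁ symiso (u a b f))).
  apply: (@iso_epi _ _ _ (compiso (rwiso (u b c g) _) (lwiso _ (u a b f)))).
  rewrite [LHS]vcomp_assoc -[X in _ ∘ X]u_comp /= inv_fwd_k; va.
  rewrite -!(reassoc (interchange _ _)).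
  rewrite (reassoc1 (iso_inv_fwd (rwiso (u b c g) _))) vcomp_id_l.
  by rewrite (iso_inv_fwd (lwiso _ (u a b f))) vcomp_id_r.
exists (icon_pseudonat f1 f2 f3 f4 f5 g1 g2 g3 g4 g5 u_nat u_id u_comp).
exists (icon_pseudonat g1 g2 g3 g4 g5 f1 f2 f3 f4 f5 v_nat v_id v_comp).
have lunit_inv (a : C) : is_invertible (lunit (id1 a)).
  by exists (iso_inv (lunit (id1 a))); rewrite iso_inv_fwd iso_fwd_inv.
split; unshelve eexists.
- exists (fun a => iso_fwd (lunit (id1 (o a)))) => a b f.
  have := vpaste_unit_square (symiso (u a b f)) (u a b f).
  by rewrite /= iso_fwd_inv unit_square_id => <-.
- exists (fun a => iso_fwd (lunit (id1 (o a)))) => a b f.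
  have := vpaste_unit_square (u a b f) (symiso (u a b f)).
  by rewrite /= iso_inv_fwd unit_square_id => <-.
- by move=> a; apply: lunit_inv.
- by move=> a; apply: lunit_inv.
Qed.

(** Brings an arbitrary pseudofunctor into the form required by
    [icon_equivalent]. *)
Lemma pseudofunctor_eta (F : Pseudofunctor B C) :
  F = Build_Pseudofunctor (pf_comp_nat_l F) (pf_comp_nat_r F) (pf_lunit F)
        (pf_runit F) (pf_assoc F).
Proof. by case: F. Qed.

Lemma pseudonat_equivalent_sym (F G : Pseudofunctor B C) :
  pseudonat_equivalent F G -> pseudonat_equivalent G F.
Proof. by case=> s [t [Hst Hts]]; exists t, s. Qed.
End Icons.

(** * A form of the pentagon *)

Lemma pentagon_inv (B : Bicategory) (a b c d e : B) (k : hom d e) (h : hom c d)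
    (g : hom b c) (f : hom a b) :
  (assoc k h g ▷ f) ∘ iso_inv (assoc (k · h) g f)
  = iso_inv (assoc k (h · g) f) ∘ (k ◁ iso_inv (assoc h g f)) ∘ assoc k h (g · f).
Proof.
apply: (@iso_mono _ _ _ (assoc k (h · g) f)).
apply: (@iso_mono _ _ _ (lwiso k (assoc h g f))).
apply: (@iso_epi _ _ _ (assoc (k · h) g f)).
rewrite /=; va; rewrite fwd_inv_k iso_inv_fwd vcomp_id_r.
rewrite (reassoc1 (iso_fwd_inv (lwiso k (assoc h g f)))) vcomp_id_l.
by rewrite pentagon; va.
Qed.

(** * Unit laws of a relative pseudomonad *)

Section UnitLaws.
Context (A E : Bicategory) (J : Pseudofunctor A E) (T : RelPseudomonad J).

(** The unit axiom of the pseudomonad, solved for the inverse of [eta]. *)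
Lemma mu_unit_r (X Y : A) (g : hom (J X) (T Y)) :
  runit (rp_ext T g) ∘ ((rp_ext T g ◁ rp_theta T X) ∘ rp_mu T g (rp_unit T X))
  = fmap (rp_ext T) (iso_inv (rp_eta T g)).
Proof.
apply: (@iso_epi _ _ _ (fmapiso (rp_ext T) (rp_eta T g))).
by rewrite vcomp_assoc /= rp_unital -fmap_comp iso_inv_fwd fmap_id iso_fwd_inv.
Qed.

(** Whiskering with the extension of the unit is faithful, since [theta] makes that
    1-cell isomorphic to the identity. *)
Lemma ext_unit_whisk_inj (X Y : A) (f f' : hom (J X) (T Y))
  (x y : rp_ext T f ⇒ rp_ext T f') :
  rp_ext T (rp_unit T Y) ◁ x = rp_ext T (rp_unit T Y) ◁ y -> x = y.
Proof.
move=> H; apply: lwhisk1_inj.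
apply: (@iso_epi _ _ _ (rwiso (rp_theta T Y) (rp_ext T f))).
by rewrite /= -!interchange H.
Qed.

(** Whisker with [i^*], where [i] is the unit of [Y], and precompose with
    [mu_{i, i^* f}] and [(mu_{i,i} f)^*].  Associativity of [mu] for [i, i, f] rewrites
    one side and naturality of [mu_{i,-}] the other; then [mu_unit_r] turns both into
    [mu_{i,f}] after [((eta_i^{-1})^* f)^*]. *)
Lemma mu_unit_l (X Y : A) (f : hom (J X) (T Y)) :
  lunit (rp_ext T f) ∘ ((rp_theta T Y ▷ rp_ext T f) ∘ rp_mu T (rp_unit T Y) f)
  = fmap (rp_ext T) (lunit f ∘ (rp_theta T Y ▷ f)).
Proof.
apply: ext_unit_whisk_inj.
apply: (@iso_epi _ _ _ (rp_mu T (rp_unit T Y) (rp_ext T (rp_unit T Y) · f))).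
apply: (@iso_epi _ _ _ (fmapiso (rp_ext T)
  (compiso (assoc (rp_ext T (rp_unit T Y)) (rp_ext T (rp_unit T Y)) f)
           (rwiso (rp_mu T (rp_unit T Y) (rp_unit T Y)) f)))).
rewrite /= -rp_mu_nat_r [RHS]vcomp_assoc -fmap_comp !lwhisk_comp; va.
have := rp_mult (rp_unit T Y) (rp_unit T Y) f; va => <-.
rewrite -(reassoc (assoc_nat_m _ _ _)).
rewrite (reassoc1 (triangle _ _)).
rewrite !(reassoc1 (eq_sym (rwhisk_comp _ _ _))); va.
(* [mu_unit_r] for the associativity side here, for the naturality side below *)
rewrite mu_unit_r -rp_mu_nat_l; congr (_ ∘ fmap _ _).
rewrite -(reassoc (assoc_nat_m _ _ _)) (reassoc1 (triangle _ _)).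
by rewrite -!rwhisk_comp mu_unit_r.
Qed.

(** The right unitor of a composite in the Kleisli bicategory, which is the inverse of
    [eta], is determined by the unitor of its first factor. *)
Lemma mu_eta (X Y Z : A) (g : hom (J Y) (T Z)) (f : hom (J X) (T Y)) :
  assoc (rp_ext T g) (rp_ext T f) (rp_unit T X)
    ∘ ((rp_mu T g f ▷ rp_unit T X) ∘ rp_eta T (rp_ext T g · f))
  = rp_ext T g ◁ rp_eta T f.
Proof.
have := runit_hcomp (B := Kl T) g f; rewrite /= => H.
apply: (@iso_mono _ _ _ (lwiso (rp_ext T g) (symiso (rp_eta T f)))).
rewrite [RHS](iso_inv_fwd (lwiso _ (rp_eta T f))).
by rewrite -!vcomp_assoc [X in X ∘ _]vcomp_assoc H iso_inv_fwd.
Qed.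

(** In the Kleisli bicategory, [theta] and the inverse of [eta] give the two unitors,
    which coincide at an identity 1-cell. *)
Lemma theta_eta (X : A) :
  lunit (rp_unit T X) ∘ ((rp_theta T X ▷ rp_unit T X) ∘ rp_eta T (rp_unit T X))
  = idarr (rp_unit T X).
Proof.
have := lunit_runit_id1 (B := Kl T) X; rewrite /= => H.
by rewrite -vcomp_assoc H iso_inv_fwd.
Qed.

End UnitLaws.

(** * Extension as a pseudomorphism of free pseudoalgebras *)

Section ExtensionRestriction.
Context (A E : Bicategory) (J : Pseudofunctor A E) (T : RelPseudomonad J).
Local Notation Free X := (free_pseudoalgebra T X).

Definition ext_morphism (X Y : A) (f : hom (J X) (T Y)) :
  Pseudomorphism (Free X) (Free Y).
Proof.
exists (rp_ext T f) (fun W g => rp_mu T f g) => /=.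
- by move=> *; apply: rp_mu_nat_r.
- by move=> *; rewrite -rp_mult.
- by move=> *; rewrite vcomp_assoc mu_eta.
Defined.

(** Compatibility of [theta] with the structure cells is [mu_unit_l]. *)
Lemma theta_transf (X : A) :
  @is_transformation _ _ _ T _ _ (ext_morphism (rp_unit T X)) (pm_id (Free X)) (rp_theta T X).
Proof.
move=> W f /=; apply: (@iso_mono _ _ _ (lunit (rp_ext T f))).
by va; rewrite fwd_inv_k mu_unit_l -fmap_comp.
Qed.

(** Compatibility with the structure cells at [k] is the associativity axiom of [mu]
    for [g], [f] and [k]. *)
Lemma mu_transf (X Y Z : A) (g : hom (J Y) (T Z)) (f : hom (J X) (T Y)) :
  @is_transformation _ _ _ T _ _ (ext_morphism (rp_ext T g · f))
    (pm_comp (ext_morphism g) (ext_morphism f)) (rp_mu T g f).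
Proof.
move=> W k /=; apply: (@iso_mono _ _ _ (assoc (rp_ext T g) (rp_ext T f) (rp_ext T k))).
by have := rp_mult g f k; va; rewrite -fmap_comp fwd_inv_k.
Qed.

Lemma ext_transf (X Y : A) (f f' : hom (J X) (T Y)) (x : f ⇒ f') :
  @is_transformation _ _ _ T _ _ (ext_morphism f) (ext_morphism f') (fmap (rp_ext T) x).
Proof. by move=> W k; apply: rp_mu_nat_l. Qed.

(** * Pseudomorphisms as extensions of their restrictions *)

(** Witnesses the freeness of [Free X]: up to this isomorphism, which by
    [extension_iso_transf] respects the algebra structure, a pseudomorphism is
    recovered from its restriction along the unit. *)
Definition extension_iso (X : A) (N : Pseudoalgebra T) (h : Pseudomorphism (Free X) N) :
  Iso (pa_ext N (h · rp_unit T X)) h :=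
  compiso (runit h) (compiso (lwiso h (rp_theta T X)) (pm_bar h (rp_unit T X))).

Lemma extension_iso_nat (X : A) (N : Pseudoalgebra T) (h h' : Pseudomorphism (Free X) N)
    (x : Transformation h h') :
  extension_iso h' ∘ fmap (pa_ext N) (proj1_sig x ▷ rp_unit T X)
  = proj1_sig x ∘ extension_iso h.
Proof.
case: x => x Hx; rewrite /extension_iso /=; va; rewrite Hx /= -(reassoc (interchange _ _)).
by rewrite (reassoc (runit_nat _)).
Qed.

(** Multiplicativity of [h] at [i] and [f] followed by [mu_unit_l] for [f]. *)
Lemma extension_iso_transf (X Y : A) (N : Pseudoalgebra T)
    (h : Pseudomorphism (Free X) N) (f : hom (J Y) (T X)) :
  pm_bar h f ∘ fmap (pa_ext N) (extension_iso h ▷ f)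
  = (extension_iso h ▷ rp_ext T f) ∘ pa_hat (p := N) (h · rp_unit T X) f.
Proof.
have M := pm_mult h (rp_unit T X) f; rewrite /= in M.
have L := mu_unit_l f.
rewrite /extension_iso /= !rwhisk_comp; va; rewrite -!triangle; va.
rewrite !(reassoc (assoc_nat_m _ _ _)).
move: M; va => <-; rewrite !lwhisk_comp_k; va; rewrite L.
have /= bar_nat := pm_nat h (lunit f ∘ (rp_theta T X ▷ f)).
by rewrite -(reassoc bar_nat) -fmap_comp lwhisk_comp; va.
Qed.

(** Unitality of [h] at [i] followed by [theta_eta]. *)
Lemma extension_iso_eta (X : A) (N : Pseudoalgebra T) (h : Pseudomorphism (Free X) N) :
  (extension_iso h ▷ rp_unit T X) ∘ pa_tilde (p := N) (h · rp_unit T X)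
  = idarr _.
Proof.
rewrite /extension_iso /= !rwhisk_comp; va; rewrite -triangle; va.
rewrite (reassoc (assoc_nat_m _ _ _)).
have := pm_unital h (rp_unit T X); rewrite /= => U.
rewrite vcomp_assoc in U; rewrite U -!lwhisk_comp theta_eta lwhisk_id //.
Qed.

(** The structure cell of [h g] is that of [h] followed by that of [g], so the
    comparison for [h g] is the comparison for [g] after a structure cell of [h];
    [extension_iso_transf] moves the comparison for [h] past that cell. *)
Lemma extension_iso_comp (X Y : A) (N : Pseudoalgebra T)
    (h : Pseudomorphism (Free Y) N) (g : Pseudomorphism (Free X) (Free Y)) :
  extension_iso (pm_comp h g)
    ∘ fmap (pa_ext N) (iso_inv (assoc h g (rp_unit T X))
                        ∘ (extension_iso h ▷ (g · rp_unit T X)))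
  = (h ◁ extension_iso g)
    ∘ ((extension_iso h ▷ rp_ext T (g · rp_unit T X))
       ∘ pa_hat (p := N) (h · rp_unit T Y) (g · rp_unit T X)).
Proof.
rewrite -extension_iso_transf /extension_iso /= fmap_comp; va.
rewrite (reassoc1 (iso_fwd_inv (fmapiso (pa_ext N) (assoc h g (rp_unit T X))))).
rewrite vcomp_id_l -runit_hcomp !lwhisk_comp; va; congr vcomp.
by rewrite (reassoc (assoc_nat_r _ _ _)) fwd_inv_k.
Qed.

Lemma extension_iso_id (X : A) :
  extension_iso (pm_id (Free X)) ∘ fmap (rp_ext T) (iso_inv (lunit (rp_unit T X)))
  = rp_theta T X.
Proof.
rewrite /extension_iso /= -lunit_runit_id1; va.
rewrite -fmap_comp iso_fwd_inv fmap_id vcomp_id_r.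
by rewrite (reassoc (lunit_nat _)) iso_fwd_inv vcomp_id_r.
Qed.

(** Links the two comparisons: on extensions, the one for pseudomorphisms is the image
    of the one for 1-cells, which is a triangle identity for the equivalence. *)
Lemma extension_iso_ext (X Y : A) (f : hom (J X) (T Y)) :
  iso_fwd (extension_iso (ext_morphism f)) = fmap (rp_ext T) (iso_inv (rp_eta T f)).
Proof. exact: mu_unit_r. Qed.

(* Only the laws above are used from here on, never the formula for the comparison. *)
#[local] Opaque extension_iso.

(** * Extension and restriction as pseudofunctors *)

Definition restrict_functor (X Y : A) :
  Functor (@hom (ImF T) X Y) (@hom (Kl T) X Y).
Proof.
exists (fun h : Pseudomorphism (Free X) (Free Y) => pm_hom h · rp_unit T X)
  (fun (h h' : Pseudomorphism (Free X) (Free Y)) (x : Transformation h h') =>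
     proj1_sig x ▷ rp_unit T X).
- by move=> h; apply: rwhisk_id.
- by move=> *; apply: rwhisk_comp.
Defined.

Definition ext_functor (X Y : A) : Functor (@hom (Kl T) X Y) (@hom (ImF T) X Y).
Proof.
exists (@ext_morphism X Y : hom _ _ -> PsAlg_hom (Free X) (Free Y))
  (fun f f' x => exist _ _ (@ext_transf X Y f f' x)).
- by move=> f; apply: transf_ext; apply: fmap_id.
- by move=> *; apply: transf_ext; apply: fmap_comp.
Defined.

(** The unit laws are [mu_unit_l] and [mu_unit_r], and the associativity law is that of
    [mu]. *)
Definition ext_pseudofunctor : Pseudofunctor (Kl T) (ImF T).
Proof.
unshelve refine (@Build_Pseudofunctor (Kl T) (ImF T) (fun X => X) ext_functor
  (fun X => symiso (transf_iso (@theta_transf X)))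
  (fun X Y Z g f => symiso (transf_iso (@mu_transf X Y Z g f))) _ _ _ _ _).
- move=> X Y Z g g' y f; apply: transf_ext => /=.
  by rewrite (inv_swap (rp_mu_nat_l _ _)).
- move=> X Y Z g f f' x; apply: transf_ext => /=.
  by rewrite (inv_swap (rp_mu_nat_r _ _)).
- move=> X Y f; apply: transf_ext => /=.
  rewrite -mu_unit_l; va; rewrite fwd_inv_k.
  by rewrite (iso_fwd_inv (rwiso (rp_theta T Y) _)) vcomp_id_r.
- move=> X Y f; apply: transf_ext => /=.
  rewrite -mu_unit_r; va; rewrite fwd_inv_k.
  by rewrite (iso_fwd_inv (lwiso _ (rp_theta T X))) vcomp_id_r.
- move=> W X Y Z h g f; apply: transf_ext => /=.
  apply: (@iso_epi _ _ _ (rwiso (rp_mu T h g) (rp_ext T f))).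
  apply: (@iso_epi _ _ _ (rp_mu T (rp_ext T h · g) f)).
  apply: (@iso_mono _ _ _ (rp_mu T h (rp_ext T g · f))).
  apply: (@iso_mono _ _ _ (lwiso (rp_ext T h) (rp_mu T g f))).
  have := rp_mult h g f; va => /= H; va; rewrite fwd_inv_k.
  rewrite (reassoc1 (iso_fwd_inv (lwiso _ (rp_mu T g f)))) vcomp_id_l H.
  rewrite (reassoc1 (iso_inv_fwd (rwiso (rp_mu T h g) _))) vcomp_id_l.
  by rewrite iso_inv_fwd vcomp_id_r.
Defined.

(** The compositor replaces the extension [(h i)^*], which composition in the Kleisli
    bicategory introduces, by [h] itself.  The left unit law is then
    [extension_iso_id], the right one [extension_iso_eta], and the associativity law
    [extension_iso_comp]. *)
Definition restrict_pseudofunctor : Pseudofunctor (ImF T) (Kl T).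
Proof.
unshelve refine (@Build_Pseudofunctor (ImF T) (Kl T) (fun X => X) restrict_functor
  (fun X => symiso (lunit (rp_unit T X)))
  (fun X Y Z (h : Pseudomorphism (Free Y) (Free Z))
       (g : Pseudomorphism (Free X) (Free Y)) =>
     compiso (symiso (assoc h g (rp_unit T X)))
             (rwiso (extension_iso h) (g · rp_unit T X))) _ _ _ _ _).
- move=> X Y Z h h' y g /=; va.
  have /= nat := extension_iso_nat y; rewrite -rwhisk_comp nat rwhisk_comp.
  by rewrite (reassoc (inv_swap (assoc_nat_l _ _ _))).
- move=> X Y Z h g g' x /=; va; rewrite interchange.
  by rewrite (reassoc (inv_swap (assoc_nat_m _ _ _))).
- move=> X Y f /=; va; rewrite -rwhisk_comp extension_iso_id -lunit_hcomp; va.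
  by rewrite fwd_inv_k.
- move=> X Y f /=; va; rewrite interchange -triangle; va; rewrite fwd_inv_k.
  rewrite (reassoc1 (iso_fwd_inv (lwiso _ (lunit (rp_unit T X))))) vcomp_id_l.
  apply: (@iso_epi _ _ _ (rp_eta T (pm_hom f · rp_unit T X))).
  have /= -> := extension_iso_eta f.
  by rewrite iso_inv_fwd.
- move=> W X Y Z h g f /=; va.
  rewrite -rwhisk_comp; have /= -> := extension_iso_comp h g.
  move: (extension_iso h) (extension_iso g) => r s.
  rewrite !rwhisk_comp !lwhisk_comp; va.
  rewrite !(reassoc (interchange _ _)) -(reassoc (assoc_nat_l _ _ _)).
  rewrite -(reassoc (assoc_nat_m _ _ _)) -!vcomp_assoc; do 3!congr vcomp.
  exact: pentagon_inv.
Defined.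

(** * The two comparisons with the identity *)

Lemma restrict_ext_equivalent :
  pseudonat_equivalent (comppf restrict_pseudofunctor ext_pseudofunctor) (idpf (Kl T)).
Proof.
rewrite (pseudofunctor_eta (comppf _ _)) (pseudofunctor_eta (idpf _)).
apply: (@icon_equivalent (Kl T) (Kl T) (fun X => X)
  (fun X Y => compfunctor (restrict_functor X Y) (ext_functor X Y)) _ _ _ _ _ _ _
  (fun X Y => idfunctor (@hom (Kl T) X Y)) _ _ _ _ _ _ _
  (fun X Y f => rp_eta T f)) => /=.
- by move=> *; apply: rp_eta_nat.
- move=> X; rewrite vcomp_id_r.
  apply: (@iso_mono _ _ _ (rwiso (rp_theta T X) (rp_unit T X))).
  apply: (@iso_mono _ _ _ (lunit (rp_unit T X))).
  rewrite [LHS]theta_eta /= (reassoc1 (iso_fwd_inv (rwiso (rp_theta T X) _))).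
  by rewrite vcomp_id_l iso_fwd_inv.
- move=> X Y Z g f; rewrite vcomp_id_r extension_iso_ext; va.
  rewrite (reassoc1 (iso_inv_fwd (rwiso (fmapiso (rp_ext T) (rp_eta T g)) _))).
  rewrite vcomp_id_l -mu_eta inv_fwd_k.
  by rewrite (reassoc1 (iso_inv_fwd (rwiso (rp_mu T g f) _))) vcomp_id_l.
Qed.

(** [extension_iso_pf_id] and [extension_iso_pf_comp] are the icon conditions at
    identities and at composites: the 2-cells after [extension_iso] are the unit and
    the compositor of extension after restriction. *)
Lemma extension_iso_pf_id (X : A) :
  extension_iso (pm_id (Free X))
    ∘ (fmap (rp_ext T) (iso_inv (lunit (rp_unit T X))) ∘ iso_inv (rp_theta T X))
  = idarr _.
Proof. by rewrite -vcomp_assoc extension_iso_id; apply: iso_fwd_inv. Qed.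

Lemma extension_iso_pf_comp (X Y Z : A)
    (h : Pseudomorphism (Free Y) (Free Z)) (g : Pseudomorphism (Free X) (Free Y)) :
  extension_iso (pm_comp h g)
    ∘ (fmap (rp_ext T) (iso_inv (assoc h g (rp_unit T X))
                        ∘ (extension_iso h ▷ (g · rp_unit T X)))
       ∘ iso_inv (rp_mu T (h · rp_unit T Y) (g · rp_unit T X)))
  = (extension_iso h ▷ pm_hom g) ∘ (rp_ext T (h · rp_unit T Y) ◁ extension_iso g).
Proof.
rewrite -vcomp_assoc; have /= -> := extension_iso_comp h g.
by va; rewrite iso_fwd_inv vcomp_id_r -interchange.
Qed.

Definition extension_transf_iso (X Y : A) (h : @hom (ImF T) X Y) :
  Iso (compfunctor (ext_functor X Y) (restrict_functor X Y) h) h :=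
  @transf_iso _ _ _ T _ _ (ext_morphism _) _ _
    (fun Z f => @extension_iso_transf X Z (Free Y) h f).

Lemma ext_restrict_equivalent :
  pseudonat_equivalent (comppf ext_pseudofunctor restrict_pseudofunctor) (idpf (ImF T)).
Proof.
apply: pseudonat_equivalent_sym.
rewrite (pseudofunctor_eta (comppf _ _)) (pseudofunctor_eta (idpf _)).
apply: (@icon_equivalent (ImF T) (ImF T) (fun X => X)
  (fun X Y => idfunctor (@hom (ImF T) X Y)) _ _ _ _ _ _ _
  (fun X Y => compfunctor (ext_functor X Y) (restrict_functor X Y)) _ _ _ _ _ _ _
  extension_transf_iso).
- by move=> X Y h h' x; apply: transf_ext; apply: extension_iso_nat.
- by move=> X; apply: transf_ext; apply: extension_iso_pf_id.
- move=> X Y Z h g; apply: transf_ext; rewrite [RHS]vcomp_id_l.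
  exact: extension_iso_pf_comp.
Qed.
End ExtensionRestriction.

Theorem corollary6p15 (A E : Bicategory) (J : Pseudofunctor A E)
    (T : RelPseudomonad J) (HE : Is2Category E) :
  biequivalent (Kl T) (ImF T).
Proof.
exists (ext_pseudofunctor T), (restrict_pseudofunctor T); split.
- exact: restrict_ext_equivalent.
- exact: ext_restrict_equivalent.
Qed.
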